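(* Fix an integer $r\ge 2$. For every constant $C>(2^r e r)^{1/(r-1)}$ there is a constant $A>0$ such that the following holds. Let $(H(n))_n$ be a sequence of linear $r$-uniform hypergraphs, $H(n)$ having $n$ vertices and maximum degree $\Delta=\Delta(n)$, and let $k=k(n)$, $\sigma=\sigma(n)$ be integers with $k\le\sigma$, $k\ge A(\log n)^{1/r}$ and $\sigma\ge C\Delta^{1/(r-1)}$. If $L$ is a random $(k,\sigma)$-list assignment for $H(n)$, then $\mathbb{P}[H(n)\text{ is }L\text{-colorable}]\to 1$ as $n\to\infty$.
   Context: A hypergraph is linear if any two distinct vertices lie in at most one common edge. A random $(k,\sigma)$-list assignment $L$ for $H$ is obtained by choosing, for each vertex $v$ independently, the list $L(v)$ uniformly at random among all $k$-element subsets of $\{1,\dots,\sigma\}$. $H$ is $L$-colorable if there is a map $\varphi$ with $\varphi(v)\in L(v)$ for all $v$ such that no edge is monochromatic. $\log$ is the natural logarithm. *)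

(* Defs.v *)
From HB Require Import structures.
From mathcomp Require Import all_boot all_order all_algebra.
From mathcomp Require Import all_classical all_reals all_analysis.
Set Implicit Arguments. Unset Strict Implicit. Unset Printing Implicit Defensive.
Import Order.TTheory GRing.Theory Num.Theory.
Local Open Scope ring_scope.

Definition uniform (n r : nat) (E : {set {set 'I_n}}) : bool :=
  [forall e in E, #|e| == r]%N.

Definition linear_hg (n : nat) (E : {set {set 'I_n}}) : bool :=
  [forall u : 'I_n, forall v : 'I_n,
     (u != v) ==> (#|[set e in E | (u \in e) && (v \in e)]| <= 1)%N].

Definition hdeg (n : nat) (E : {set {set 'I_n}}) (v : 'I_n) : nat :=
  #|[set e in E | v \in e]|.

Definition maxdeg (n : nat) (E : {set {set 'I_n}}) : nat :=
  (\max_(v : 'I_n) hdeg E v)%N.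

Definition list_assignments (n k sigma : nat) : {set {ffun 'I_n -> {set 'I_sigma}}} :=
  [set L : {ffun 'I_n -> {set 'I_sigma}} | [forall v, #|L v| == k]%N].

Definition monochromatic (n sigma : nat) (phi : {ffun 'I_n -> 'I_sigma})
  (e : {set 'I_n}) : bool :=
  [exists c : 'I_sigma, e \subset [set v | phi v == c]].

Definition L_colorable (n sigma : nat) (E : {set {set 'I_n}})
  (L : {ffun 'I_n -> {set 'I_sigma}}) : bool :=
  [exists phi : {ffun 'I_n -> 'I_sigma},
     [forall v, phi v \in L v] && [forall e in E, ~~ monochromatic phi e]].

(* probability that H is L-colourable for a uniformly random
   (k,sigma)-list assignment L (lists chosen independently and uniformly
   = uniform distribution on the product set list_assignments). *)
Definition prob_colorable (R : realType) (n k sigma : nat)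
  (E : {set {set 'I_n}}) : R :=
  (#|[set L in list_assignments n k sigma | L_colorable E L]|%:R
     / #|list_assignments n k sigma|%:R).

(* Main.v *)
(** Delete from each list L(v) the heavy colours c, those for which more than
    twice the expected number of edges e at v have c in L(u) for all other
    vertices u of e.  Write mu = k^(r-1) / (2^r e r), an upper bound for that
    expectation.

    Probability.  For a set S of m colours of L(v), the sum of their colour
    degrees at v is a sum over the edges e at v of the number of colours of S
    common to the lists of e minus v.  By linearity these edges are disjoint
    outside v, and the indicators of "c in L(u)" for distinct c are negatively
    correlated, so 2 to the power of this sum has expectation at most
    exp(mu m).  By Markov, S consists of heavy colours with probability at most
    exp(-c mu m).  Taking m = k/2 and a union bound over the at most 2^k sets S
    and the n vertices, with high probability no vertex loses half of its list,
    as mu k is of order k^r >= A^r log n.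

    Colouring.  When all lists keep at least l = k/2 colours and all colour
    degrees are at most 2 mu <= l^(r-1) / (e r), a proper colouring exists by
    Rosenfeld's counting argument: among all choices of colours from the lists,
    at least a fraction t = (r-1)/r of those that are proper on a vertex set S
    remain proper on S + v. *)
Require Import Defs.
From HB Require Import structures.
From mathcomp Require Import all_boot all_order all_algebra.
From mathcomp Require Import all_classical all_reals all_analysis.
From mathcomp Require Import zify ring lra.
(* Imported again so that their names take precedence over those of
   [classical_sets]. *)
From mathcomp Require Import fintype finset.
Import Order.TTheory GRing.Theory Num.Theory.
Import numFieldNormedType.Exports.
Set Implicit Arguments. Unset Strict Implicit. Unset Printing Implicit Defensive.
Local Open Scope ring_scope.

(** * Uniform k-sets containing a given set *)

(** Each further element of [T] multiplies the count by (k - t) / (|K| - t), at most k / |K|. This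
    is the negative correlation of the events that distinct colours lie in a random list. *)
Lemma card_supersets (K : finType) (T : {set K}) k : (k <= #|K|)%N ->
  (#|[set l : {set K} | (T \subset l) && (#|l| == k)]| * #|K| ^ #|T|
     <= 'C(#|K|, k) * k ^ #|T|)%N.
Proof.
move=> lekK.
(* Passing to complements gives a binomial coefficient that vanishes for |T| > k, where a truncated
   k - |T| would wrongly give 1. *)
have -> : #|[set l : {set K} | (T \subset l) && (#|l| == k)]| =
          'C(#|K| - #|T|, #|K| - k).
  have -> : (#|K| - #|T|)%N = #|~: T| by rewrite [RHS]cardsCs setCK.
  rewrite -cards_draws -(card_imset _ (@setC_inj K)); apply: eq_card => l.
  rewrite !inE; apply/imsetP/andP => [[l' + ->]|[sub /eqP cl]].
    by rewrite inE => /andP[? /eqP cl]; rewrite setCS cardsCs setCK cl.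
  exists (~: l); last by rewrite setCK.
  by rewrite inE -setCS setCK sub cardsCs setCK cl subKn /=.
have: (#|T| <= #|K|)%N by exact: max_card.
elim: #|T| => [_|t IH lttK]; first by rewrite subn0 !muln1 bin_sub.
have {}IH := IH (ltnW lttK).
have /= := mul_bin_down (#|K| - t) (#|K| - k).
rewrite (_ : (#|K| - t).-1 = #|K| - t.+1)%N; last by lia.
set a := 'C(_, _) => Ea; set b := 'C(_, _) in IH.
rewrite (_ : (#|K| - t - (#|K| - k)) = k - t)%N in Ea; last by lia.
rewrite !expnS.
have step : (a * #|K| <= b * k)%N.
  have ht : (0 < #|K| - t)%N by lia.
  rewrite -(leq_pmul2l ht) mulnA Ea -/b.
  have h : ((k - t) * #|K| <= k * (#|K| - t))%N.
    rewrite mulnBl mulnBr; apply: leq_sub => //.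
    by nia.
  have -> : ((k - t) * b * #|K| = b * ((k - t) * #|K|))%N by lia.
  have -> : ((#|K| - t) * (b * k) = b * (k * (#|K| - t)))%N by lia.
  by rewrite leq_mul2l h orbT.
have -> : (a * (#|K| * #|K| ^ t) = a * #|K| * #|K| ^ t)%N by lia.
apply: (@leq_trans (b * k * #|K| ^ t)); first by rewrite leq_mul2r step orbT.
have -> : ('C(#|K|, k) * (k * k ^ t) = k * ('C(#|K|, k) * k ^ t))%N by lia.
have -> : (b * k * #|K| ^ t = k * (b * #|K| ^ t))%N by lia.
by rewrite leq_mul2l IH orbT.
Qed.

(** * Rosenfeld's counting argument for list colouring *)

Section Counting.
Variables (R : realFieldType) (V K : finType) (E : {set {set V}}) (M : V -> {set K}).

Definition mono (phi : {ffun V -> K}) (c : K) (e : {set V}) := e \subset [set v | phi v == c].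

(* Total choices of colours from the lists, of which only the edges inside [S]
   are required to be properly coloured. *)
Definition partial_colorings (S : {set V}) : {set {ffun V -> K}} :=
  [set phi in family (fun v => mem (M v)) |
     [forall e in E, (e \subset S) ==> [forall c, ~~ mono phi c e]]].

Lemma partial_colorings0 : set0 \notin E -> (forall v, M v != set0) ->
  (0 < #|partial_colorings set0|)%N.
Proof.
move=> E0 M0; have [f fP] := fin_all_exists (fun v => elimT (set0Pn _) (M0 v)).
apply/card_gt0P; exists (finfun f); rewrite !inE; apply/andP; split.
  by apply/familyP => v; rewrite ffunE; exact: fP.
apply/forall_inP => e eE; apply/implyP; rewrite subset0 => /eqP e0.
by rewrite -e0 eE in E0.
Qed.

(** Recolouring [u] with any colour of [M u] leaves the edges inside [S] proper, as [u] is outside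
    [S]. Nothing is lost, because the old colour of [u] was [c]. *)
Lemma colorings_mono_step (S e : {set V}) (u : V) (c : K) : u \notin S -> u \notin e ->
  (#|[set phi in partial_colorings S | mono phi c (u |: e)]| * #|M u|
    <= #|[set phi in partial_colorings S | mono phi c e]|)%N.
Proof.
move=> uS ue.
pose up (x : {ffun V -> K} * K) := [ffun w => if w == u then x.2 else x.1 w].
rewrite -cardsX -(card_in_imset (f := up)); last first.
  move=> [f a] [g b] /setXP[/= + _] /setXP[/= + _] /ffunP eqfg.
  rewrite !inE => /andP[_ /subsetP fm] /andP[_ /subsetP gm].
  have /= := eqfg u; rewrite !ffunE eqxx => /= ->; congr (_, _).
  apply/ffunP => w; have /= := eqfg w; rewrite !ffunE /=; case: eqP => // -> _.
  have := fm u (setU11 _ _); have := gm u (setU11 _ _).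
  by rewrite !inE => /eqP -> /eqP ->.
apply/subset_leq_card/subsetP => psi /imsetP[[f a] /setXP[/= + aM] ->].
rewrite !inE => /andP[/andP[/familyP fM /forall_inP prop] /subsetP fm].
have upE (e' : {set V}) c' : u \notin e' -> mono (up (f, a)) c' e' = mono f c' e'.
  move=> ue'; apply/subsetP/subsetP => h w we; have := h w we; rewrite !inE ffunE;
  by case: (w =P u) => // wu; move: ue'; rewrite -wu we.
rewrite upE //; apply/andP; split; last first.
  by apply/subsetP => w we; apply: fm; rewrite inE we orbT.
apply/andP; split.
  by apply/familyP => w; rewrite ffunE /=; case: eqP => // ->.
apply/forall_inP => e' e'E; apply/implyP => e'S.
apply/forallP => c'; rewrite upE; last by apply: contra uS => /(subsetP e'S).
by have /implyP/(_ e'S)/forallP/(_ c') := prop e' e'E.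
Qed.

(** Vertices outside [S] are unconstrained, so each vertex dropped from [e] gains a factor [l]. *)
Lemma colorings_mono (l : R) : 0 <= l -> (forall v, l <= #|M v|%:R) ->
  forall (S e : {set V}) (c : K), [disjoint e & S] ->
  #|[set phi in partial_colorings S | mono phi c e]|%:R * l ^+ #|e|
    <= #|partial_colorings S|%:R.
Proof.
move=> l0 lM S e c; elim: {e}_.+1 {-2}e (ltnSn #|e|) => // m IH e em.
have [->|[u ue]] := set_0Vmem e => [_|dis].
  rewrite cards0 expr0 mulr1 ler_nat subset_leq_card //.
  by apply/subsetP => phi; rewrite inE => /andP[].
have uS : u \notin S by rewrite (disjointFr dis).
have ce : #|e| = #|e :\ u|.+1 by rewrite (cardsD1 u) ue.
have := IH (e :\ u); rewrite -ltnS -ce => /(_ em).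
have dis' : [disjoint e :\ u & S] by apply: disjointWl dis; exact: subsetDl.
move=> /(_ dis'); apply: le_trans.
rewrite ce exprS mulrA ler_wpM2r ?exprn_ge0 //.
have := @colorings_mono_step S (e :\ u) u c uS; rewrite !inE eqxx /= => /(_ isT).
rewrite setD1K // -(ler_nat R) natrM; apply: le_trans.
by rewrite ler_wpM2l.
Qed.

Lemma leq_card_bigcup (I T : finType) (P : pred I) (F : I -> {set T}) :
  (#|\bigcup_(i | P i) F i| <= \sum_(i | P i) #|F i|)%N.
Proof.
elim/big_rec2: _ => [|i n A _ le]; first by rewrite cards0.
by apply: leq_trans (leq_card_setU _ _) _; rewrite leq_add2l.
Qed.

Lemma partial_coloringsS (A B : {set V}) :
  A \subset B -> partial_colorings B \subset partial_colorings A.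
Proof.
move=> AB; apply/subsetP => phi; rewrite !inE => /andP[-> /forall_inP h] /=.
apply/forall_inP => e eE; apply/implyP => eA.
by move: (h e eE); rewrite (subset_trans eA AB).
Qed.

(** The one-vertex bound telescopes. It is asked only below size [m] because the induction in
    [extend_coloring] knows it only for sets smaller than the current one. *)
Lemma extend_iter (t : R) (m : nat) : 0 <= t ->
  (forall (S : {set V}) v, (#|S| < m)%N -> v \notin S ->
     t * #|partial_colorings S|%:R <= #|partial_colorings (v |: S)|%:R) ->
  forall A B : {set V}, [disjoint B & A] -> (#|A| + #|B| <= m)%N ->
  t ^+ #|B| * #|partial_colorings A|%:R <= #|partial_colorings (B :|: A)|%:R.
Proof.
move=> t0 step A B; elim: {B}_.+1 {-2}B (ltnSn #|B|) => // b IH B Bb.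
have [->|[u uB]] := set_0Vmem B => [_ _|dis AB].
  by rewrite cards0 expr0 mul1r set0U.
have cB : #|B| = #|B :\ u|.+1 by rewrite (cardsD1 u) uB.
have dis' : [disjoint B :\ u & A] by apply: disjointWl dis; exact: subsetDl.
have := IH (B :\ u); rewrite -ltnS -cB => /(_ Bb dis') {}IH.
have cU : #|(B :\ u) :|: A| = (#|B :\ u| + #|A|)%N.
  by rewrite cardsU (disjoint_setI0 dis') cards0 subn0.
have := step ((B :\ u) :|: A) u; rewrite cU setUA setD1K // => {}step.
apply: le_trans (step _ _).
- by rewrite cB exprS -mulrA ler_wpM2l // IH; lia.
- lia.
- by rewrite !inE eqxx /= (disjointFr dis).
Qed.

(** A choice proper on [S] but not on S + v has an edge e at v in a single colour c. Relative to the
    choices proper on [S], those with given e and c number at most 1 / (|M v| (t l)^s), where t^s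
    pays for passing from S minus e to S. Summing over |M v| colours and at most [D] edges for each
    gives at most 1 - t. *)
Lemma extend_coloring (s : nat) (t l D : R) :
  0 < t -> 0 < l -> {in E, forall e : {set V}, #|e| = s.+1} ->
  (forall v, l <= #|M v|%:R) ->
  (forall v c, c \in M v ->
     #|[set e in E | (v \in e) && [forall u in e, c \in M u]]|%:R <= D) ->
  D <= (1 - t) * (t * l) ^+ s ->
  forall (S : {set V}) v, v \notin S ->
    t * #|partial_colorings S|%:R <= #|partial_colorings (v |: S)|%:R.
Proof.
move=> t0 l0 unif lM degD Dle S; elim: {S}_.+1 {-2}S (ltnSn #|S|) => // m IH S Sm v vS.
have IHS (A B : {set V}) : [disjoint B & A] -> (#|A| + #|B| <= #|S|)%N ->
    t ^+ #|B| * #|partial_colorings A|%:R <= #|partial_colorings (B :|: A)|%:R.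
  apply: extend_iter; first exact: ltW.
  by move=> S' v' S'S; apply: IH; apply: leq_trans S'S _.
pose bad := partial_colorings S :\: partial_colorings (v |: S).
pose Ec c := [set e in E | [&& v \in e, [forall u in e, c \in M u] & e \subset v |: S]].
(* Properness is kept only on S minus e, so that the vertices of e are free and the bounds on
   monochromatic sets apply. *)
pose B e c := [set phi in partial_colorings (S :\: e) | mono phi c e].
have cbad : #|partial_colorings S| = (#|partial_colorings (v |: S)| + #|bad|)%N.
  rewrite -(cardsID (partial_colorings (v |: S)) (partial_colorings S)).
  by have /setIidPr -> := partial_coloringsS (subsetUr [set v] S).
have bad_sub : bad \subset \bigcup_(c in M v) \bigcup_(e in Ec c) B e c.
  apply/subsetP => phi; rewrite inE => /andP[notvS inS].
  have := subsetP (partial_coloringsS (subsetDl S _)) _ inS => inSe.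
  move: notvS inS; rewrite !inE => /nandP[nf /andP[f _]|]; first by rewrite f in nf.
  move=> /forall_inPn[e eE]; rewrite negb_imply => /andP[evS].
  move=> /forallPn[c]; rewrite negbK => me /andP[/familyP fM prop].
  have ve : v \in e.
    apply: contraLR me => ve; move/forall_inP: prop => /(_ e eE)/implyP h.
    apply: (forallP (h _)); apply/subsetP => w we.
    by move: (subsetP evS w we); rewrite !inE => /orP[/eqP wv|//]; rewrite -wv we in ve.
  have cM u : u \in e -> c \in M u.
    by move=> ue; have := subsetP me u ue; rewrite inE => /eqP <-; exact: fM.
  apply/bigcupP; exists c; first exact: cM.
  apply/bigcupP; exists e; last by rewrite inE inSe me.
  by rewrite inE eE ve evS andbT /=; apply/forall_inP.
have Mv0 : 0 < #|M v|%:R :> R by apply: lt_le_trans (lM v).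
have Bbound e c : e \in Ec c ->
    (#|M v|%:R * (t * l) ^+ s) * #|B e c|%:R <= #|partial_colorings S|%:R.
  rewrite inE => /and4P[eE ve _ evS].
  have ce : #|e :\ v| = s by have := unif e eE; rewrite (cardsD1 v) ve => -[].
  have disE : [disjoint e :\ v & S :\: e].
    by rewrite -setI_eq0; apply/eqP/setP => w; rewrite !inE; case: (w \in e); rewrite ?andbF.
  have eS : (e :\ v) :|: (S :\: e) = S.
    apply/setP => w; rewrite !inE; case: eqP => [->|wv] /=.
      by rewrite (negPf vS) andbF.
    case we: (w \in e) => //=; have := subsetP evS w we.
    by rewrite !inE => /orP[/eqP//|->].
  (* At v the exact list size is needed, to cancel against the number of colours c; at the other
     vertices [l] suffices. *)
  have h1 := @colorings_mono_step (S :\: e) (e :\ v) v c.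
  rewrite setD1K // !inE eqxx (negPf vS) andbF /= in h1.
  have {}h1 := h1 isT isT.
  have h2 := colorings_mono (ltW l0) lM c disE; rewrite ce in h2.
  have h3 := IHS _ _ disE; rewrite eS ce in h3.
  have cS : #|S| = (s + #|S :\: e|)%N.
    by rewrite -[in LHS]eS cardsU (disjoint_setI0 disE) cards0 subn0 ce.
  have {}h3 := h3 (eq_leq (etrans (addnC _ _) (esym cS))).
  apply: le_trans h3.
  rewrite exprMn (mulrC #|M v|%:R) -!mulrA ler_wpM2l ?(exprn_ge0 _ (ltW t0)) //.
  rewrite mulrC; apply: le_trans h2; rewrite ler_wpM2r ?(exprn_ge0 _ (ltW l0)) //.
  by rewrite mulrC -natrM ler_nat.
have badle : (t * l) ^+ s * #|bad|%:R <= D * #|partial_colorings S|%:R.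
  rewrite -(ler_pM2l Mv0) mulrA.
  apply: le_trans (_ : (#|M v|%:R * (t * l) ^+ s) * \sum_(c in M v) \sum_(e in Ec c) #|B e c|%:R <= _).
    rewrite ler_wpM2l ?mulr_ge0 ?exprn_ge0 ?mulr_ge0 ?(ltW t0) ?(ltW l0) //.
    under eq_bigr do rewrite -natr_sum.
    rewrite -natr_sum ler_nat; apply: leq_trans (subset_leq_card bad_sub) _.
    apply: leq_trans (leq_card_bigcup _ _) _; apply: leq_sum => c _.
    exact: leq_card_bigcup.
  have -> : #|M v|%:R * (D * #|partial_colorings S|%:R) =
      \sum_(c in M v) D * #|partial_colorings S|%:R by rewrite sumr_const mulr_natl.
  rewrite mulr_sumr; apply: ler_sum => c cM.
  rewrite mulr_sumr; apply: le_trans; first by apply: ler_sum => e; exact: Bbound.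
  rewrite sumr_const -[X in X <= _]mulr_natl ler_wpM2r //.
  apply: le_trans (degD v c cM); rewrite ler_nat; apply: subset_leq_card.
  by apply/subsetP => e; rewrite !inE => /and4P[-> -> ->].
have tl : 0 < (t * l) ^+ s by rewrite exprn_gt0 ?mulr_gt0.
have : (t * l) ^+ s * #|bad|%:R <= (t * l) ^+ s * ((1 - t) * #|partial_colorings S|%:R).
  apply: le_trans badle _; rewrite mulrA (mulrC _ (1 - t)).
  by rewrite ler_wpM2r.
rewrite ler_pM2l // => bb.
have : #|partial_colorings S|%:R = #|partial_colorings (v |: S)|%:R + #|bad|%:R :> R.
  by rewrite cbad natrD.
by lra.
Qed.

(** Adding all vertices to the empty set, where the count is positive, keeps it positive. *)
Lemma list_coloring (s : nat) (t l D : R) :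
  0 < t -> 0 < l -> {in E, forall e : {set V}, #|e| = s.+1} ->
  (forall v, l <= #|M v|%:R) ->
  (forall v c, c \in M v ->
     #|[set e in E | (v \in e) && [forall u in e, c \in M u]]|%:R <= D) ->
  D <= (1 - t) * (t * l) ^+ s ->
  exists phi : {ffun V -> K}, (forall v, phi v \in M v) /\
    {in E, forall (e : {set V}) c, ~~ (e \subset [set v | phi v == c])}.
Proof.
move=> t0 l0 unif lM degD Dle.
have dis : [disjoint [set: V] & set0] by rewrite -setI_eq0 setI0.
have := @extend_iter t #|V| (ltW t0) _ set0 setT dis.
rewrite cards0 cardsT setU0 => le; have {}le := le _ (leqnn _).
have {}le := le (fun S v _ => extend_coloring t0 l0 unif lM degD Dle (v := v)).
have P0 : (0 < #|partial_colorings set0|)%N.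
  apply: partial_colorings0 => [|v].
    by apply/negP => /unif; rewrite cards0.
  by rewrite -card_gt0 -(ltr_nat R); apply: lt_le_trans (lM v).
have : 0 < #|partial_colorings setT|%:R :> R.
  by apply: lt_le_trans le; rewrite mulr_gt0 ?exprn_gt0 // ltr0n.
rewrite ltr0n => /card_gt0P[phi]; rewrite inE => /andP[/familyP fM /forall_inP prop].
exists phi; split; first exact: fM.
by move=> e eE c; have := prop e eE; rewrite subsetT => /forallP/(_ c).
Qed.
End Counting.

(** * Exponential moments of colour degrees *)

(** The list of [v] is left out, so that colour degrees at [v] do not depend on [L v]. *)
Definition color_deg (V K : finType) (E : {set {set V}}) (L : V -> {set K}) v c :=
  #|[set e in E | (v \in e) && [forall u in e :\ v, c \in L u]]|.

Lemma card_supersets_prob (R : realFieldType) (K : finType) (T : {set K}) k :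
  (k <= #|K|)%N ->
  \sum_(l : {set K} | #|l| == k) (T \subset l)%:R
    <= 'C(#|K|, k)%:R * (k%:R / #|K|%:R) ^+ #|T| :> R.
Proof.
move=> kK; rewrite -natr_sum -big_mkcondr /= sum1_card.
have -> : #|[pred l : {set K} | (#|l| == k) && (T \subset l)]| =
    #|[set l : {set K} | (T \subset l) && (#|l| == k)]|.
  by apply: eq_card => l; rewrite !inE andbC.
have := card_supersets T kK.
(* For empty [K] the quotient is 0 by convention, but then [T] is empty and the exponent is 0. *)
have [K0|K0] := posnP #|K|.
  have -> : T = set0 by apply/eqP; rewrite -cards_eq0 -leqn0 -K0 max_card.
  by rewrite cards0 !expn0 !muln1 expr0 mulr1 ler_nat.
rewrite -(ler_nat R) !natrM !natrX expr_div_n mulrA => h.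
by rewrite ler_pdivlMr // exprn_gt0 // ltr0n.
Qed.

Lemma sum_powerset_exp (R : comPzRingType) (K : finType) (S : {set K}) (x : R) :
  \sum_(T in powerset S) x ^+ #|T| = (1 + x) ^+ #|S|.
Proof.
rewrite addrC exprD1n (partition_big (fun T : {set K} => inord #|T| : 'I_#|S|.+1) xpredT) //=.
apply: eq_bigr => i _.
rewrite (eq_bigr (fun=> x ^+ i)); last first.
  move=> T; rewrite inE => /andP[TS /eqP <-]; rewrite inordK // ltnS.
  exact: subset_leq_card.
rewrite sumr_const -cards_draws; congr (_ *+ _); rewrite -[RHS]cardsE.
apply: eq_card => T; rewrite unfold_in !inE; case TS: (T \subset S) => //=.
by rewrite -val_eqE /= inordK // ltnS subset_leq_card.
Qed.

Section ExpMoment.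
Variables (R : realFieldType) (V K : finType) (E : {set {set V}}) (k s : nat).
Hypothesis linE : forall u v : V, u != v -> (#|[set e in E | (u \in e) && (v \in e)]| <= 1)%N.
Hypothesis unifE : {in E, forall e : {set V}, #|e| = s.+1}.
Hypothesis kK : (k <= #|K|)%N.

Let q : R := k%:R / #|K|%:R.

(* Writing [2 ^ n] as the number of subsets of an [n]-set makes each summand a
   product over the vertices, so no independence statement is needed. *)
Lemma exp_color_deg (L : V -> {set K}) v (S : {set K}) :
  2 ^+ (\sum_(c in S) color_deg E L v c) =
  \prod_(e in [set e in E | v \in e]) \sum_(T in powerset S)
     \prod_(u in e :\ v) (T \subset L u)%:R :> R.
Proof.
(* Pairs of a colour and an edge are counted twice; [M e] holds the colours common to the lists of e
   minus v. *)
pose M e := [set c | [forall u in e :\ v, c \in L u]].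
have -> : (\sum_(c in S) color_deg E L v c = \sum_(e in [set e in E | v \in e]) #|S :&: M e|)%N.
  under eq_bigr => c _ do rewrite /color_deg -sum1_card.
  under [RHS]eq_bigr => e _ do rewrite -sum1_card.
  rewrite (exchange_big_dep (mem [set e in E | v \in e])) /=; last first.
    by move=> c e _; rewrite !inE => /and3P[-> ->].
  apply: eq_bigr => e; rewrite inE => /andP[eE ve]; apply: eq_bigl => c.
  by rewrite !inE eE ve.

rewrite -prodrXr; apply: eq_bigr => e _.
rewrite -natrX -card_powerset -sum1_card natr_sum powersetI.
rewrite (eq_bigl (fun T => (T \in powerset S) && (T \subset M e))); last first.
  by move=> T; rewrite !inE.
rewrite big_mkcondr /=; apply: eq_bigr => T _.
case: ifP => [/subsetP TM|/negbT /subsetPn[c cT]].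
  rewrite big1 // => u ue; case: subsetP => // -[] c cT.
  by have := TM c cT; rewrite inE => /forall_inP/(_ u ue).
rewrite inE => /forall_inPn[u ue cu]; rewrite (bigD1 u) //=.
by case: subsetP => [/(_ c cT)|_]; rewrite ?(negPf cu) // mul0r.
Qed.

(** The sum factors over the vertices. By linearity a vertex other than [v] lies on at most one edge
    e at v, so its list meets at most one condition, of probability at most q^|f e|. Each edge at
    [v] has s such vertices. *)
Lemma sum_prod_subset_le (v : V) (S : {set K}) (f : {set V} -> {set K}) :
  \sum_(L : {ffun V -> {set K}} | [forall w, #|L w| == k])
     (S \subset L v)%:R * \prod_(e in [set e in E | v \in e])
        \prod_(u in e :\ v) (f e \subset L u)%:R
   <= (\sum_(l : {set K} | #|l| == k) (S \subset l)%:R) * 'C(#|K|, k)%:R ^+ #|V|.-1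
      * \prod_(e in [set e in E | v \in e]) (q ^+ s) ^+ #|f e| :> R.
Proof.
set Ev := [set e in E | v \in e].
pose g w (l : {set K}) : R := if w == v then (S \subset l)%:R
  else \prod_(e in Ev | w \in e) (f e \subset l)%:R.
have exch (F : {set V} -> V -> R) :
    \prod_(e in Ev) \prod_(u in e :\ v) F e u =
    \prod_(w | w != v) \prod_(e in Ev | w \in e) F e w.
  rewrite (exchange_big_dep (fun w => w != v)) /=; last first.
    by move=> e w _; rewrite !inE => /andP[].
  apply: eq_bigr => w wv; apply: eq_bigl => e.
  by rewrite [w \in _ :\ _]inE in_set1 wv.
rewrite (eq_bigr (fun L : {ffun V -> {set K}} => \prod_w g w (L w))); last first.
  move=> L _; rewrite [RHS](bigD1 v) //= {1}/g eqxx exch; congr (_ * _).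
  by apply: eq_bigr => w /negPf wv; rewrite /g wv.
rewrite (eq_bigl (mem (ffun_on [pred l : {set K} | #|l| == k]))); last first.
  by move=> L; apply/forallP/ffun_onP.
(* Independence of the lists: a sum over assignments becomes a product of sums over single lists. *)
rewrite -(bigA_distr_big _ g) (bigD1 v) //=.
rewrite -mulrA {1}/g eqxx ler_wpM2l //; first by rewrite sumr_ge0.
have q0 : 0 <= q by rewrite divr_ge0.
apply: le_trans (_ : \prod_(w | w != v) ('C(#|K|, k)%:R * \prod_(e in Ev | w \in e) q ^+ #|f e|) <= _).
  apply: ler_prod => w wv; apply/andP; split.
    by apply: sumr_ge0 => l _; rewrite /g (negPf wv) prodr_ge0.
  rewrite /g (negPf wv).
  have uniq_e e e' : e \in Ev -> w \in e -> e' \in Ev -> w \in e' -> e' = e.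
    rewrite !inE => /andP[eE ve] we /andP[e'E ve'] we'.
    have /card_le1_eqP := linE wv; apply; by rewrite inE ?eE ?e'E ?we ?we' ?ve ?ve'.
  have [/existsP[e /andP[eEv we]]|no] := boolP [exists e, (e \in Ev) && (w \in e)].
    have one e' : (e' \in Ev) && (w \in e') = (e' == e).
      apply/andP/eqP => [[e'Ev we']|-> //].
      exact: uniq_e we _ _.
    rewrite (eq_bigl _ _ one) big_pred1_eq.
    under eq_bigr do rewrite (eq_bigl _ _ one) big_pred1_eq.
    exact: card_supersets_prob.
  have none e : (e \in Ev) && (w \in e) = false.
    by apply/negP => h; case/existsP: no; exists e.
  rewrite [X in _ <= _ * X]big_pred0 // mulr1.
  under eq_bigr do rewrite big_pred0 //.
  rewrite sumr_const -card_draws; rewrite -[X in X%:R <= _]cardsE //.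
rewrite big_split /= prodr_const cardC1 ler_wpM2l ?exprn_ge0 //.
rewrite -(exch (fun e _ => q ^+ #|f e|)).
rewrite (eq_bigr (fun e => (q ^+ s) ^+ #|f e|)) // => e; rewrite inE => /andP[eE ve].
have ce : #|e :\ v| = s by have := unifE eE; rewrite (cardsD1 v) ve => -[].
by rewrite prodr_const ce exprAC.
Qed.

(** The product over the edges at [v] is expanded into choices [f] of a subset of [S] for each edge,
    bounded term by term and folded back by the binomial theorem. *)
Lemma exp_moment (v : V) (S : {set K}) :
  \sum_(L : {ffun V -> {set K}} | [forall w, #|L w| == k])
     (S \subset L v)%:R * 2 ^+ (\sum_(c in S) color_deg E L v c)
   <= (\sum_(l : {set K} | #|l| == k) (S \subset l)%:R) * 'C(#|K|, k)%:R ^+ #|V|.-1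
      * (1 + q ^+ s) ^+ (#|S| * #|[set e in E | v \in e]|) :> R.
Proof.
(* [set0] is the value of [f] off the edges at [v]. *)
under eq_bigr => L _ do rewrite exp_color_deg (big_distr_big set0) /= mulr_sumr.
rewrite exchange_big /=.
apply: le_trans; first by apply: ler_sum => f _; exact: sum_prod_subset_le.
rewrite -mulr_sumr -(big_distr_big set0 (mem [set e in E | v \in e]) (mem (powerset S))
  (fun _ T => (q ^+ s) ^+ #|T|)) /=.
by rewrite prodr_const sum_powerset_exp exprM.
Qed.

End ExpMoment.

(** * Tail bound for the number of heavy colours *)

Definition heavy (R : realFieldType) (V K : finType) (E : {set {set V}}) (D : R)
  (L : V -> {set K}) v := [set c in L v | D < (color_deg E L v c)%:R].

(** Markov's inequality and a union bound over the m-subsets of the list at [v]. As [D] is real, [B]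
    stands in for 2^D. *)
Lemma heavy_lists_bound (R : realFieldType) (V K : finType) (E : {set {set V}}) (k s m : nat)
    (D B : R) (v : V) :
  (forall u v : V, u != v -> (#|[set e in E | (u \in e) && (v \in e)]| <= 1)%N) ->
  {in E, forall e : {set V}, #|e| = s.+1} -> (k <= #|K|)%N ->
  0 <= B -> (forall d : nat, D < d%:R -> B <= 2 ^+ d) ->
  #|[set L : {ffun V -> {set K}} |
      [forall w, #|L w| == k] && (m <= #|heavy E D L v|)%N]|%:R * B ^+ m
    <= 'C(k, m)%:R * 'C(#|K|, k)%:R ^+ #|V|
       * (1 + (k%:R / #|K|%:R) ^+ s) ^+ (m * #|[set e in E | v \in e]|).
Proof.
move=> linE unifE kK B0 DB.
set LA := fun L : {ffun V -> {set K}} => [forall w, #|L w| == k].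
apply: le_trans (_ : \sum_(L | LA L) \sum_(S : {set K} | #|S| == m)
   (S \subset L v)%:R * 2 ^+ (\sum_(c in S) color_deg E L v c) <= _).
  rewrite mulr_natl -sumr_const big_set big_mkcondr /=; apply: ler_sum => L _.
  case: ifP => [mle|_]; last by rewrite sumr_ge0 // => S _; rewrite mulr_ge0 ?exprn_ge0.
  have : (0 < #|[set S : {set K} | S \subset heavy E D L v & #|S| == m]|)%N.
    by rewrite cards_draws bin_gt0.
  case/card_gt0P=> S; rewrite inE => /andP[/subsetP Sh Sm].
  rewrite (bigD1 S) //=; apply: ler_wpDr.
    by apply: sumr_ge0 => T _; rewrite mulr_ge0 ?exprn_ge0.
  have -> : S \subset L v by apply/subsetP => c /Sh; rewrite inE => /andP[].
  rewrite mul1r expr_sum -(eqP Sm) -prodr_const; apply: ler_prod => c /Sh.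
  by rewrite inE => /andP[_ /DB ->]; rewrite B0.
rewrite exchange_big /=.
apply: le_trans.
  by apply: ler_sum => S _; apply: (exp_moment R linE unifE kK v S).
set P := _ ^+ #|V|.-1.
rewrite (eq_bigr (fun S : {set K} => (\sum_(l : {set K} | #|l| == k) (S \subset l)%:R) *
   (P * (1 + (k%:R / #|K|%:R) ^+ s) ^+ (m * #|[set e in E | v \in e]|)))); last first.
  by move=> S /eqP ->; rewrite mulrA.
have pow0 : 0 <= (1 + (k%:R / #|K|%:R) ^+ s) ^+ (m * #|[set e in E | v \in e]|) :> R.
  by apply/exprn_ge0/addr_ge0 => //; apply/exprn_ge0/divr_ge0.
rewrite -mulr_suml mulrA; apply: ler_wpM2r => //.
(* Summing over lists first shows that only the 'C(k, m) subsets of each list count. *)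
rewrite exchange_big /=.
rewrite (eq_bigr (fun=> 'C(k, m)%:R)); last first.
  move=> l /eqP lk; rewrite -natr_sum -big_mkcondr /= sum1_card -lk -cards_draws.
  by congr (_%:R); apply: eq_card => S; rewrite !inE andbC.
rewrite sumr_const /P.
have -> : #|(fun l : {set K} => #|l| == k)| = 'C(#|K|, k).
  by rewrite -card_draws -[LHS]cardsE.
have -> : #|V| = #|V|.-1.+1 by rewrite prednK //; apply/card_gt0P; exists v.
by rewrite exprS /= mulrA -[_ *+ 'C(#|K|, k)]mulr_natr.
Qed.

(** * Numerical estimates *)

(* Any exponent above [1 / 2] would do: it makes [2 ^ (2 * mu)] beat [expR mu]. *)
Lemma expR_four_sevenths (R : realType) : expR (4 / 7 : R) <= 2.
Proof.
(* This gives exp(2/7) <= 7/5, and (7/5)^2 = 49/25 < 2. *)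
have h : (5 / 7 : R) <= expR (- (2 / 7)) by have := expR_ge1Dx (- (2 / 7) : R); lra.
have -> : 4 / 7 = - (- (2 / 7) + - (2 / 7)) :> R by lra.
rewrite expRN expRD -[leRHS]invrK lef_pV2 ?posrE; try by rewrite ?invr_gt0 ?mulr_gt0 ?expR_gt0.
by nra.
Qed.

(** Equivalent to (1 + 1/s)^s <= e; it bounds t^s for t = s/(s+1) and is the source of e in the
    condition on C. *)
Lemma expRN1_le_pow (R : realType) (s : nat) : (0 < s)%N ->
  expR (-1) <= (s%:R / s.+1%:R) ^+ s :> R.
Proof.
move=> s0; have sR : 0 < s%:R :> R by rewrite ltr0n.
rewrite -[leRHS]invrK expRN lef_pV2 ?posrE ?expR_gt0 //; last first.
  by rewrite invr_gt0 exprn_gt0 // divr_gt0.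
rewrite -exprVn invf_div; apply: le_trans (_ : expR (s%:R^-1) ^+ s <= _).
  rewrite ler_pXn2r ?nnegrE ?expR_ge0 ?divr_ge0 //.
  apply: le_trans (expR_ge1Dx _); rewrite -natr1 mulrDl divff ?mul1r //.
  by rewrite gt_eqF.
by rewrite -expRM_natl mulfV // gt_eqF.

Qed.

(** Each of the m heavy colours gains 8x/7 at a cost of x, and m >= k/2 turns the surplus m x/7 into
    k x/14. *)
Lemma exponent_le (R : realFieldType) (k m x : R) : 0 <= x -> k <= 2 * m ->
  k + m * x <= k - k * x / 14 + m * (4 / 7 * (2 * x)).
Proof. by move=> x0 /(ler_wpM2r x0); lra. Qed.

(** * Colouring probability for a fixed hypergraph *)

Section Hypergraph.
Variables (R : realType) (n s k sigma : nat) (E : {set {set 'I_n}}).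
Hypothesis linE : forall u v : 'I_n, u != v -> (#|[set e in E | (u \in e) && (v \in e)]| <= 1)%N.
Hypothesis unifE : {in E, forall e : {set 'I_n}, #|e| = s.+1}.
Hypotheses (s0 : (0 < s)%N) (k0 : (0 < k)%N).

Let mu : R := k%:R ^+ s / (2 ^+ s.+1 * expR 1 * s.+1%:R).

Lemma L_colorable_few_heavy (L : {ffun 'I_n -> {set 'I_sigma}}) :
  (forall v, #|L v| = k) ->
  (forall v, (#|heavy E (2 * mu) L v| < uphalf k)%N) -> L_colorable E L.
Proof.
move=> Lk few; pose M v := L v :\: heavy E (2 * mu) L v.
(* The value t = s/(s+1) maximises (1 - t) t^s. *)
have [||||||phi [phiM prop]] := @list_coloring R _ _ E M s (s%:R / s.+1%:R) (k%:R / 2) (2 * mu).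
- by rewrite divr_gt0 ?ltr0n.
- by rewrite divr_gt0 ?ltr0n.
- exact: unifE.
- move=> v; rewrite ler_pdivrMr // -natrM ler_nat.
  have := few v; have := cardsID (heavy E (2 * mu) L v) (L v).
  have /finset.setIidPr -> : heavy E (2 * mu) L v \subset L v.
    by apply/fintype.subsetP => c; rewrite inE => /andP[].
  by rewrite Lk -/(M v); lia.
- move=> v c; rewrite inE => /andP[+ cL]; rewrite inE cL /= -leNgt.
  apply: le_trans; rewrite ler_nat; apply: subset_leq_card.
  apply/fintype.subsetP => e; rewrite !inE => /and3P[-> -> /forall_inP h] /=.
  apply/forall_inP => u; rewrite inE => /andP[_ /h].
  by rewrite inE => /andP[].
- have -> : 1 - s%:R / s.+1%:R = s.+1%:R^-1 :> R.
    by rewrite -natr1; field; rewrite natr1 pnatr_eq0.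
  rewrite exprMn /mu mulrA [leRHS]mulrC -mulrA.
  have := expRN1_le_pow R s0; rewrite expRN => h.
  set x := (_ ^+ s) in h *.
  have kk : 0 <= k%:R ^+ s :> R by rewrite exprn_ge0.
  have e0 : 0 < expR 1 :> R := expR_gt0 1.
  have -> : 2 * (k%:R ^+ s / (2 ^+ s.+1 * expR 1 * s.+1%:R)) =
     (expR 1)^-1 * ((k%:R / 2) ^+ s / s.+1%:R) :> R.
    rewrite exprS expr_div_n; field.
    by rewrite nat1r pnatr_eq0 expf_neq0 ?gt_eqF // pnatr_eq0.
  rewrite -mulrA; apply: ler_wpM2r => //.
apply/existsP; exists phi; apply/andP; split.
  by apply/forallP => v; have := phiM v; rewrite inE => /andP[].
by apply/forall_inP => e eE; apply/existsPn => c; exact: prop.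
Qed.

(** A union bound over the vertices that may have at least [uphalf k] heavy colours. The hypothesis
    bounds the expected colour degrees by [mu]. *)
Lemma prob_colorable_ge : (k <= sigma)%N ->
  (forall v, (k%:R / sigma%:R) ^+ s * #|[set e in E | v \in e]|%:R <= 
     k%:R ^+ s / (2 ^+ s.+1 * expR 1 * s.+1%:R) :> R) ->
  1 - n%:R * expR (k%:R - k%:R * mu / 14) <= prob_colorable R k sigma E <= 1.
Proof.
move=> kS degle.
pose LA := list_assignments n k sigma; pose N : R := 'C(sigma, k)%:R ^+ n.
have cLA : #|LA|%:R = N :> R.
  have -> : LA = [set L in ffun_on [pred l : {set 'I_sigma} | #|l| == k]].
    by apply/setP => L; rewrite [LHS]inE [RHS]inE; apply/forallP/ffun_onP.
  rewrite /N; have -> : 'C(sigma, k) = #|[set l : {set 'I_sigma} | #|l| == k]| by rewrite card_draws card_ord.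
  rewrite cardsE card_ffun_on card_ord natrX.
  by congr (_%:R ^+ _); rewrite -[LHS]cardsE.
have N0 : 0 < N by rewrite exprn_gt0 // ltr0n bin_gt0.
pose m := uphalf k.
pose good := [set L in LA | L_colorable E L].
pose bad v := [set L : {ffun 'I_n -> {set 'I_sigma}} |
  [forall w, #|L w| == k] && (m <= #|heavy E (2 * mu) L v|)%N].
have goodsub : good \subset LA by apply/fintype.subsetP => L; rewrite inE => /andP[].
rewrite /prob_colorable -/LA -/good cLA ler_pdivrMr // ler_pdivlMr // mul1r.
apply/andP; split; last by rewrite -cLA ler_nat subset_leq_card.
have covered : LA :\: good \subset \bigcup_v bad v.
  apply/fintype.subsetP => L; rewrite !inE => /andP[+ LLA]; rewrite LLA /= => nc.
  apply/finset.bigcupP; apply: contraNP nc => nobad.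
  apply: L_colorable_few_heavy => v; first by have /forallP/(_ v)/eqP := LLA.
  rewrite ltnNge; apply/negP => h; apply: nobad; exists v => //.
  by rewrite inE LLA.
have cgood : #|LA|%:R = #|good|%:R + #|LA :\: good|%:R :> R.
  rewrite -natrD -(cardsID good LA); congr (_ + _)%:R.
  by have /finset.setIidPr -> := goodsub.
have badle v : #|bad v|%:R <= N * expR (k%:R - k%:R * mu / 14).
  (* An exponential lower bound for 2^(2 mu). *)
  pose B : R := expR (4 / 7 * (2 * mu)).
  have B0 : 0 < B := expR_gt0 _.
  have muB d : 2 * mu < d%:R -> B <= 2 ^+ d.
    move=> mud; apply: le_trans (_ : expR (4 / 7) ^+ d <= _); last first.
      by rewrite lerXn2r ?nnegrE ?expR_ge0 // expR_four_sevenths.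
    rewrite -expRM_natr ler_expR ler_wpM2l // ltW //.
  have kK : (k <= #|'I_sigma|)%N by rewrite card_ord.
  have := heavy_lists_bound m v linE unifE kK (ltW B0) muB.
  rewrite -/(bad v) !card_ord -/N mulrAC => h.
  have Bm : 0 < B ^+ m by rewrite exprn_gt0.
  rewrite -(ler_pM2r Bm); apply: le_trans h _.
  rewrite mulrC -[leRHS]mulrA ler_wpM2l ?(ltW N0) //.
  have mu0 : 0 <= mu.
    by rewrite /mu divr_ge0 ?exprn_ge0 // !mulr_ge0 ?exprn_ge0 ?expR_ge0.
  have Cle : 'C(k, m)%:R <= expR (k%:R) :> R.
    apply: le_trans (_ : 2 ^+ k <= _).
      rewrite -natrX ler_nat; have := max_card [set A : {set 'I_k} | #|A| == m].
      by rewrite card_draws -[in leqRHS]cardsT -powersetT card_powerset cardsT !card_ord.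
    rewrite -[k%:R]mul1r expRM_natr lerXn2r ?nnegrE ?expR_ge0 //.
    by have := expR_ge1Dx (1 : R); lra.
  have q0 : 0 <= (k%:R / sigma%:R) ^+ s :> R by rewrite exprn_ge0 // divr_ge0.
  have powle : (1 + (k%:R / sigma%:R) ^+ s) ^+ (m * #|[set e in E | v \in e]|)
      <= expR (m%:R * mu) :> R.
    apply: le_trans (_ : expR ((k%:R / sigma%:R) ^+ s) ^+ (m * #|[set e in E | v \in e]|) <= _).
      by rewrite lerXn2r ?nnegrE ?expR_ge0 ?expR_ge1Dx // addr_ge0.
    by rewrite -expRM_natl ler_expR natrM -mulrA ler_wpM2l // mulrC degle.
  apply: le_trans (_ : expR k%:R * expR (m%:R * mu) <= _).
    by apply: ler_pM => //; rewrite exprn_ge0 // addr_ge0.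
  rewrite /B -expRM_natl -!expRD ler_expR.
  have mk : k%:R <= 2 * m%:R :> R by rewrite -natrM ler_nat mul2n uphalfK leq_addl.
  exact: exponent_le.
have : #|LA :\: good|%:R <= n%:R * (N * expR (k%:R - k%:R * mu / 14)).
  apply: le_trans (_ : (\sum_v #|bad v|)%:R <= _).
    by rewrite ler_nat (leq_trans (subset_leq_card covered)) // leq_card_bigcup.
  rewrite natr_sum -[X in X%:R * _]card_ord mulr_natl -sumr_const.
  by apply: ler_sum => v _; exact: badle.
rewrite mulrBl mul1r -mulrA (mulrC _ N) -cLA => h.
by rewrite {1}cgood; lra.
Qed.

End Hypergraph.

(** * Asymptotics and choice of the constant A *)

Lemma ler_powRV_exp (R : realType) (r : nat) (a x y : R) : (0 < r)%N ->
  0 <= a -> 0 <= x -> a * x `^ (r%:R^-1) <= y -> a ^+ r * x <= y ^+ r.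
Proof.
move=> r0 a0 x0 h; have rR : (r%:R : R) != 0 by rewrite pnatr_eq0 -lt0n.
have -> : a ^+ r * x = (a * x `^ (r%:R^-1)) ^+ r.
  by rewrite exprMn -(powR_mulrn _ (powR_ge0 _ _)) -powRrM mulVf // powRr1.
have p0 : 0 <= a * x `^ (r%:R^-1) by rewrite mulr_ge0 // powR_ge0.
by rewrite lerXn2r ?nnegrE // (le_trans p0 h).
Qed.

(** Since 56 = 4 * 14, the term k^r / (14 X) is at least 4 ln n and at least 4 k, hence at least
    their mean 2 ln n + 2 k. *)
Lemma large_list_exponent (R : realType) (r k n : nat) (X : R) : (2 <= r)%N -> 1 <= X ->
  1 <= ln (n%:R : R) -> 56 * X * (ln (n%:R : R)) `^ (r%:R^-1) <= k%:R ->
  (0 < k)%N /\ k%:R - k%:R ^+ r / X / 14 <= - (2 * ln n%:R).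
Proof.
move=> r2 X1 ln1 h; have X0 : 0 < X by lra.
have kX : 56 * X <= k%:R.
  apply: le_trans h; rewrite ler_peMr //; first by lra.
  by rewrite -[leLHS](powRr0 (ln n%:R)) ler_powR.
have k1 : 1 <= k%:R :> R by lra.
split; first by rewrite -(ltr_nat R); lra.
have hr : (56 * X) ^+ r * ln n%:R <= k%:R ^+ r.
  by apply: ler_powRV_exp h; [exact: ltnW | lra | lra].
have Xr : 56 * X <= (56 * X) ^+ r by rewrite ler_eXnr //; [lia|lra].
have h1 : 56 * X * ln n%:R <= k%:R ^+ r.
  by apply: le_trans hr; rewrite ler_wpM2r //; lra.
have h2 : 56 * X * k%:R <= k%:R ^+ r.
  apply: le_trans (_ : k%:R ^+ 2 <= _); last by rewrite ler_weXn2l.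
  by rewrite expr2 ler_wpM2r.
rewrite -ler_pdivlMl in h1; last by lra.
rewrite -ler_pdivlMl in h2; last by lra.
have e : (56 * X)^-1 * k%:R ^+ r = k%:R ^+ r / X / 14 / 4.
  by field; rewrite gt_eqF.
by move: h1 h2; rewrite e; lra.
Qed.

Unset Implicit Arguments.
Local Open Scope classical_set_scope.

Theorem theorem4p1 (R : realType) (r : nat) (hr : (2 <= r)%N) (C : R)
  (hC : (2 ^+ r * expR 1 * r%:R) `^ (r.-1%:R)^-1 < C) :
  exists A : R, 0 < A /\
  forall (E : forall n : nat, {set {set 'I_n}}) (k sigma : nat -> nat),
    (forall n, linear_hg (E n)) ->
    (forall n, uniform r (E n)) ->
    (forall n, (k n <= sigma n)%N) ->
    (forall n, A * (ln (n%:R : R)) `^ (r%:R^-1) <= (k n)%:R) ->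
    (forall n, C * ((maxdeg (E n))%:R : R) `^ (r.-1%:R^-1) <= (sigma n)%:R) ->
    (fun n => prob_colorable R (k n) (sigma n) (E n)) @ \oo --> (1 : R).
Proof.
case: r hr hC => [//|s]; rewrite ltnS => s0 /=.
set X : R := 2 ^+ s.+1 * expR 1 * s.+1%:R => hC.
have e1 : 1 <= expR 1 :> R by have := expR_ge1Dx (1 : R); lra.
have X1 : 1 <= X.
  by rewrite /X !mulr_ege1 // ?ler1n // exprn_ege1 // ler1n.
have X0 : 0 < X by lra.
have C0 : 0 <= C by apply: le_trans (ltW hC); exact: powR_ge0.
have CX : X <= C ^+ s.
  have := @ler_powRV_exp R s 1 X C s0 ler01 (ltW X0).
  by rewrite expr1n !mul1r; apply; exact: ltW.
exists (56 * X); split; first by lra.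
move=> E k sigma lin unif kS kA sC.
have cvg_low : (fun n => 1 - n%:R^-1 : R) @ \oo --> (1 : R).
  rewrite -[X in _ --> X]subr0; apply: cvgB; first exact: cvg_cst.
  by rewrite -cvg_shiftS; exact: cvg_harmonic.
apply: (squeeze_cvgr _ cvg_low (@cvg_cst _ (1 : R) _ \oo _)).
(* Only n >= e matters in the limit, and there ln n >= 1. *)
have := nbhs_infty_ger (expR 1 : R); apply: filterS => n en.
have n0 : 0 < n%:R :> R by apply: lt_le_trans en; exact: expR_gt0.
have ln1 : 1 <= ln (n%:R : R).
  by rewrite -[leLHS]expRK ler_ln ?posrE ?expR_gt0.
have [k0 kexp] := @large_list_exponent R s.+1 (k n) n X s0 X1 ln1 (kA n).
have linE u v : u != v -> (#|[set e in E n | (u \in e) && (v \in e)]%SET| <= 1)%N.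
  by move=> uv; have /forallP/(_ u)/forallP/(_ v)/implyP/(_ uv) := lin n.
have unifE : {in E n, forall e : {set 'I_n}, #|e| = s.+1}.
  by move=> e eE; have /forall_inP/(_ e eE)/eqP := unif n.
have sig0 : 0 < (sigma n)%:R :> R by rewrite ltr0n (leq_trans k0).
have degle v : ((k n)%:R / (sigma n)%:R) ^+ s * #|[set e in E n | v \in e]%SET|%:R <=
     (k n)%:R ^+ s / X :> R.
  have dv : #|[set e in E n | v \in e]%SET|%:R <= (maxdeg (E n))%:R :> R.
    by rewrite ler_nat; exact: (leq_bigmax v).
  (* As sigma^s >= C^s Delta >= X Delta, the expected colour degrees are at most k^s / X. *)
  have sX : X * (maxdeg (E n))%:R <= (sigma n)%:R ^+ s.
    apply: le_trans (ler_powRV_exp s0 C0 _ (sC n)) => //.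
    by rewrite ler_wpM2r.
  rewrite expr_div_n -mulrA ler_wpM2l ?exprn_ge0 //.
  rewrite mulrC ler_pdivrMr ?exprn_gt0 // mulrC ler_pdivlMr // mulrC.
  by apply: le_trans sX; rewrite ler_wpM2l // ltW.
have /andP[low ->] := prob_colorable_ge linE unifE s0 k0 (kS n) degle.
rewrite andbT; apply: le_trans low; rewrite lerB //.
(* The failure probability is at most n * n^(-2) = 1/n. *)
apply: le_trans (_ : n%:R * expR (- (2 * ln n%:R)) <= _).
  rewrite ler_wpM2l // ler_expR; apply: le_trans kexp.
  by rewrite lerB // exprS !mulrA.
rewrite expRN mulrC expRM_natl lnK ?posrE // expr2 invfM -mulrA mulVf ?mulr1 //.
by rewrite gt_eqF.
Qed.
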